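(* If $C$ is the set of vertices of a vertex-transitive polytope $P\subseteq\mathbb{R}^d$, then $\Psi(C)$ is the set of all $|C|!$ orderings of $C$.
   Context: For a finite multiset $V$ of points in $\mathbb{R}^d$, $D_V(x)=\sum_{v\in V}\|x-v\|$ (Euclidean norm, with multiplicity). $V$ distinguishes $C$ if the values $D_V(c)$, $c\in C$, are pairwise distinct, and then witnesses the ordering of $C$ by increasing $D_V$-value. $\Psi(C)$ is the set of all orderings of $C$ witnessed by finite nonempty multisets $V\subseteq\mathbb{R}^d$ distinguishing $C$. A polytope is vertex-transitive if its symmetry group (isometries of $\mathbb{R}^d$ preserving $P$) acts transitively on its vertices. *)

(* Defs.v *)
From HB Require Import structures.
From mathcomp Require Import all_boot all_order all_algebra.
From mathcomp Require Import finmap multiset.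
From mathcomp Require Import boolp classical_sets functions cardinality reals.

Set Implicit Arguments.
Unset Strict Implicit.
Unset Printing Implicit Defensive.

Import Order.TTheory GRing.Theory Num.Theory.
Local Open Scope mset_scope.
Local Open Scope classical_set_scope.
Local Open Scope ring_scope.

Section Defs.
Variables (R : realType) (d : nat).
Local Notation E := 'rV[R]_d.

(* Not `|x|, which on row vectors is the sup norm. *)
Definition enorm (x : E) : R := Num.sqrt (\sum_(i < d) x 0 i ^+ 2).

(* Iterating over a multiset repeats each element with its multiplicity. *)
Definition dist_sum (V : {mset E}) (x : E) : R := \sum_(v <- V) enorm (x - v).

Definition distinguishes (V : {mset E}) (C : set E) : Prop :=
  forall c c', C c -> C c' -> c <> c' -> dist_sum V c <> dist_sum V c'.

(* An ordering of C is the duplicate-free list of its elements, first one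
   first; only finite sets have orderings. *)
Definition orderings (C : set E) : set (seq E) :=
  [set s | uniq s /\ forall x : E, x \in s <-> C x].

Definition witnesses (V : {mset E}) (C : set E) (s : seq E) : Prop :=
  [/\ distinguishes V C, orderings C s &
      sorted (fun x y => dist_sum V x < dist_sum V y) s].

Definition Psi (C : set E) : set (seq E) :=
  [set s | exists V : {mset E}, V <> mset0 /\ witnesses V C s].

Definition convex_hull (S : seq E) : set E :=
  [set x | exists w : 'I_(size S) -> R,
     [/\ forall i, 0 <= w i, \sum_i w i = 1 & x = \sum_i w i *: S`_i]].

Definition polytope (P : set E) : Prop := exists S : seq E, P = convex_hull S.

(* The extreme points of P. *)
Definition vertices (P : set E) : set E :=
  [set v | P v /\ forall x y (t : R), P x -> P y -> 0 < t < 1 ->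
     v = (1 - t) *: x + t *: y -> x = v /\ y = v].

Definition eisometry (f : E -> E) : Prop :=
  bijective f /\ forall x y, enorm (f x - f y) = enorm (x - y).

Definition symmetries (P : set E) : set (E -> E) :=
  [set f | eisometry f /\ f @` P = P].

Definition vertex_transitive (P : set E) : Prop :=
  forall v w, vertices P v -> vertices P w -> exists2 f, symmetries P f & f v = w.

End Defs.

(* Main.v *)
(** Write [K x] for the sum of the distances from [x] to the points of [C];
    vertex-transitivity makes [K] constant on [C], because a symmetry permutes
    [C].  For a short vector [h], replacing a double point of [V] at [c] by the
    pair [c + h], [c - h] raises [D_V c] by [2 |h|], but raises [D_V x] only by
    [O(|h|^2)] at the other points [x] of [C].  So start from [2 n] copies of
    [C], [n = |C|], where [D_V] is constant on [C], and carry out this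
    replacement [i] times at the [i]-th point of the prescribed ordering: for
    [h] small enough, [D_V] increases along that ordering. *)

Require Import Defs.
From HB Require Import structures.
From mathcomp Require Import all_boot all_order all_algebra.
From mathcomp Require Import finmap multiset.
From mathcomp Require Import boolp classical_sets functions cardinality reals.
From mathcomp Require Import ring lra.
Import Order.TTheory GRing.Theory Num.Theory.
Local Open Scope classical_set_scope.
Local Open Scope ring_scope.

Set Implicit Arguments.
Unset Strict Implicit.
Unset Printing Implicit Defensive.

(** * The Euclidean inner product and norm *)

Section EuclideanNorm.
Variables (R : realType) (d : nat).
Implicit Types x y z a h : 'rV[R]_d.

Definition dotp x y : R := \sum_(i < d) x 0 i * y 0 i.

Lemma dotpC x y : dotp x y = dotp y x.
Proof. by apply: eq_bigr => i _; rewrite mulrC. Qed.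

Lemma dotp0l x : dotp 0 x = 0.
Proof. by apply: big1 => i _; rewrite mxE mul0r. Qed.

Lemma dotpDl x y z : dotp (x + y) z = dotp x z + dotp y z.
Proof. by rewrite /dotp -big_split; apply: eq_bigr => i _; rewrite mxE mulrDl. Qed.

Lemma dotpZl (k : R) x z : dotp (k *: x) z = k * dotp x z.
Proof. by rewrite /dotp mulr_sumr; apply: eq_bigr => i _; rewrite mxE mulrA. Qed.

Lemma dotpNl x z : dotp (- x) z = - dotp x z.
Proof. by rewrite -scaleN1r dotpZl mulN1r. Qed.

Lemma dotpDr x y z : dotp z (x + y) = dotp z x + dotp z y.
Proof. by rewrite dotpC dotpDl !(dotpC z). Qed.

Lemma dotpZr (k : R) x z : dotp z (k *: x) = k * dotp z x.
Proof. by rewrite dotpC dotpZl (dotpC z). Qed.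

Lemma dotpNr x z : dotp z (- x) = - dotp z x.
Proof. by rewrite dotpC dotpNl (dotpC z). Qed.

Definition dotpE := (dotpDl, dotpDr, dotpNl, dotpNr, dotpZl, dotpZr).

Lemma dotp_ge0 x : 0 <= dotp x x.
Proof. by apply: sumr_ge0 => i _; rewrite -expr2 sqr_ge0. Qed.

Lemma enormE x : enorm x = Num.sqrt (dotp x x).
Proof. by []. Qed.

Lemma enorm_ge0 x : 0 <= enorm x.
Proof. exact: sqrtr_ge0. Qed.

Lemma sqr_enorm x : enorm x ^+ 2 = dotp x x.
Proof. by rewrite enormE sqr_sqrtr ?dotp_ge0. Qed.

Lemma enorm_eq0 x : (enorm x == 0) = (x == 0).
Proof.
rewrite -[LHS]sqrf_eq0 sqr_enorm; apply/eqP/eqP => [|->]; last exact: dotp0l.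
move=> /psumr_eq0P x0; apply/rowP => i; rewrite mxE; apply/eqP.
by rewrite -sqrf_eq0 expr2 x0 // => j _; rewrite -expr2 sqr_ge0.
Qed.

Lemma enorm0 : enorm (0 : 'rV[R]_d) = 0.
Proof. by apply/eqP; rewrite enorm_eq0. Qed.

Lemma enorm_gt0 x : (0 < enorm x) = (x != 0).
Proof. by rewrite lt0r enorm_eq0 enorm_ge0 andbT. Qed.

Lemma enormZ (k : R) x : enorm (k *: x) = `|k| * enorm x.
Proof.
by rewrite !enormE !dotpE mulrA -expr2 sqrtrM ?sqr_ge0 // sqrtr_sqr.
Qed.

Lemma enormN x : enorm (- x) = enorm x.
Proof. by rewrite -scaleN1r enormZ normrN1 mul1r. Qed.

Lemma enormC x y : enorm (x - y) = enorm (y - x).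
Proof. by rewrite -enormN opprB. Qed.

(** Cauchy-Schwarz, from expanding the squared norm of [enorm y *: x - enorm x *: y]. *)
Lemma dotp_le_enorm x y : dotp x y <= enorm x * enorm y.
Proof.
have [->|x0] := eqVneq x 0; first by rewrite dotp0l enorm0 mul0r.
have [->|y0] := eqVneq y 0; first by rewrite dotpC dotp0l enorm0 mulr0.
have := dotp_ge0 (enorm y *: x - enorm x *: y).
rewrite !dotpE (dotpC y x) -!sqr_enorm.
move: x0 y0; rewrite -!enorm_gt0; move: (enorm x) (enorm y) => X Y X0 Y0 H.
have XY0 : 0 < X * Y by exact: mulr_gt0.
rewrite -(ler_pM2l XY0); nra.
Qed.

Lemma enormD x y : enorm (x + y) <= enorm x + enorm y.
Proof.
rewrite -ler_sqr ?nnegrE ?addr_ge0 ?enorm_ge0 //.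
rewrite sqr_enorm !dotpE (dotpC y x) -!sqr_enorm.
have := dotp_le_enorm x y; nra.
Qed.

(** The change in the distance sum at [x] when a double point at [c] becomes the pair [c + h],
    [c - h], where [a = x - c]. *)
Definition second_diff h a : R := enorm (a - h) + enorm (a + h) - 2 * enorm a.

Lemma second_diff0 h : second_diff h 0 = 2 * enorm h.
Proof. by rewrite /second_diff sub0r add0r enormN enorm0; ring. Qed.

Lemma second_diff_ge0 h a : 0 <= second_diff h a.
Proof.
have := enormD (a - h) (a + h).
have -> : a - h + (a + h) = 2 *: a.
  by rewrite addrACA addNr addr0 scaler_nat mulr2n.
by rewrite enormZ ger0_norm // subr_ge0.
Qed.

(** AM-GM: the square of [enorm a - enorm (a + h)] is nonnegative. *)
Lemma mul_enormD_le h a :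
  2 * enorm a * enorm (a + h) <= 2 * enorm a ^+ 2 + 2 * dotp a h + enorm h ^+ 2.
Proof.
have : enorm (a + h) ^+ 2 = enorm a ^+ 2 + 2 * dotp a h + enorm h ^+ 2.
  by rewrite !sqr_enorm !dotpE (dotpC h a); ring.
have := sqr_ge0 (enorm a - enorm (a + h)); nra.
Qed.

(** Adding the previous bound for [h] and for [- h] cancels the inner products. The factor [enorm a]
    on the left avoids a division. *)
Lemma second_diff_le h a : enorm a * second_diff h a <= enorm h ^+ 2.
Proof.
have := mul_enormD_le h a; have := mul_enormD_le (- h) a.
by rewrite /second_diff enormN dotpNr; nra.
Qed.

(* Points of a segment are thus characterised by distances alone, so isometries
   are affine on segments. *)
Lemma segment_point x y z (t : R) :
  enorm (z - x) = t * enorm (x - y) -> enorm (z - y) = (1 - t) * enorm (x - y) ->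
  z = (1 - t) *: x + t *: y.
Proof.
move=> zx zy; apply/eqP; rewrite -subr_eq0 -enorm_eq0 -sqrf_eq0; apply/eqP.
(* Stewart's identity; with the two given distances its right-hand side vanishes. *)
have -> : enorm (z - ((1 - t) *: x + t *: y)) ^+ 2 =
    (1 - t) * enorm (z - x) ^+ 2 + t * enorm (z - y) ^+ 2
      - t * (1 - t) * enorm (x - y) ^+ 2.
  rewrite !sqr_enorm !dotpE (dotpC y x) (dotpC y z) (dotpC x z); ring.
rewrite zx zy; ring.
Qed.

(** * Isometries, segments and vertices *)

Lemma eisometry_segment (f : 'rV[R]_d -> 'rV[R]_d) x y (t : R) :
  eisometry f -> 0 < t < 1 ->
  f ((1 - t) *: x + t *: y) = (1 - t) *: f x + t *: f y.
Proof.
move=> [_ fE] /andP[t0 t1].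
apply: segment_point => //; rewrite !fE.
  have -> : (1 - t) *: x + t *: y - x = t *: (y - x).
    by apply/rowP => i; rewrite !mxE; ring.
  by rewrite enormZ gtr0_norm // enormC.
have -> : (1 - t) *: x + t *: y - y = (1 - t) *: (x - y).
  by apply/rowP => i; rewrite !mxE; ring.
by rewrite enormZ gtr0_norm // subr_gt0.
Qed.

(** As [f] maps [P] onto itself, injectively and affinely on segments, a segment of [P] through
    [f v] pulls back to one through [v]. *)
Lemma symmetry_vertices (P : set 'rV[R]_d) f v :
  symmetries P f -> vertices P v -> vertices P (f v).
Proof.
move=> [fiso fP] [Pv vext]; have [/bij_inj finj _] := fiso.
split=> [|x' y' t]; first by rewrite -fP; exists v.
rewrite -{1 2}fP => -[x Px <-] [y Py <-] t01.
by rewrite -eisometry_segment // => /finj /vext[]// -> ->.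
Qed.

(** Single out an entry of positive weight. If the weight is 1, the vertex is that entry; otherwise
    the vertex lies strictly between the entry and the weighted average [y] of the others, and
    extremality applies. *)
Lemma vertices_convex_hull (S : seq 'rV[R]_d) v :
  vertices (convex_hull S) v -> v \in S.
Proof.
move=> [[w [w0 w1 vE]] vext].
have [i wi] : exists i, 0 < w i.
  apply: contrapT => /forallNP w_le0; move/eqP: w1.
  rewrite big1 ?(eq_sym 0) ?oner_eq0 // => i _; apply/eqP.
  by rewrite eq_le w0 andbT leNgt; apply/negP/w_le0.
have wi1 : w i + \sum_(j | j != i) w j = 1 by rewrite -w1 [RHS](bigD1 i).
have rest0 : 0 <= \sum_(j | j != i) w j by exact: sumr_ge0.
have vE' : v = w i *: S`_i + \sum_(j | j != i) w j *: S`_j.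
  by rewrite vE (bigD1 i).
have [wi_ge1|wi_lt1] := leP 1 (w i).
  have restE : \sum_(j | j != i) w j = 0 by lra.
  rewrite vE' big1 => [|j ji].
    have -> : w i = 1 by lra.
    by rewrite scale1r addr0 mem_nth.
  by have /psumr_eq0P-> := restE; rewrite ?scale0r.
pose u j := if j == i then 0 else w j / (1 - w i).
have wi1' : 1 - w i != 0 by rewrite subr_eq0 gt_eqF.
have wi_gt0 : 0 < 1 - w i by rewrite subr_gt0.
pose y := \sum_j u j *: S`_j.
have yE : (1 - w i) *: y = \sum_(j | j != i) w j *: S`_j.
  rewrite /y (bigD1 i) //= /u eqxx scale0r add0r scaler_sumr.
  apply: eq_bigr => j /negPf->; rewrite scalerA mulrC divfK //.
have Py : convex_hull S y.
  exists u; split => // [j|].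
    by rewrite /u; case: eqP => // _; rewrite divr_ge0 // ltW.
  rewrite (bigD1 i) //= /u eqxx add0r.
  under eq_bigr => j /negPf-> do [].
  by rewrite -mulr_suml; apply: canLR (mulfK wi1') _; lra.
have Pi : convex_hull S S`_i.
  exists (fun j => (j == i)%:R); split => //.
    by rewrite (bigD1 i) //= eqxx big1 ?addr0 // => j /negPf->.
  rewrite (bigD1 i) //= eqxx scale1r big1 ?addr0 // => j /negPf->.
  by rewrite scale0r.
have [||_ <-] := vext y S`_i (w i) Py Pi; last by rewrite mem_nth.
  by rewrite wi.
by rewrite yE vE' addrC.
Qed.

End EuclideanNorm.

(** * Finite lists as sets and multisets *)

Lemma card_fset_set_seq (T : choiceType) (s : seq T) :
  uniq s -> #|` fset_set [set` s]| = size s.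
Proof.
move=> us; have -> : [set` s] = [set` [fset x in s]%fset] :> set T.
  by apply/seteqP; split => x /=; rewrite inE.
by rewrite set_fsetK card_fseq undup_id.
Qed.

Lemma card_eq_seq (T : choiceType) (s : seq T) :
  uniq s -> ([set` s] #= `I_(size s))%card.
Proof.
move=> us; apply/(fcard_eq (finite_seq s) (finite_II _)).
by rewrite card_fset_set_seq // (card_fset_set (card_eqxx _)).
Qed.

Lemma finite_pos_lower_bound (R : realType) (T : eqType) (s : seq T) (F : T -> R) :
  (forall x, x \in s -> 0 < F x) ->
  exists2 e, 0 < e & forall x, x \in s -> e <= F x.
Proof.
elim: s => [|x s IH] F0; first by exists 1.
have [|e e0 eF] := IH; first by move=> y ys; apply: F0; rewrite inE ys orbT.
exists (Num.min e (F x)); first by rewrite lt_min e0 F0 ?mem_head.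
move=> y; rewrite inE => /predU1P[->|/eF]; first by rewrite ge_min lexx orbT.
by rewrite ge_min => ->.
Qed.

Lemma sum_nseq (R : pzRingType) (T : Type) n (c : T) (F : T -> R) :
  \sum_(v <- nseq n c) F v = n%:R * F c.
Proof. by rewrite big_nseq iter_addr_0 mulr_natl. Qed.

Lemma seq_mset_neq0 (T : choiceType) (s : seq T) v :
  v \in s -> seq_mset s <> mset0%mset.
Proof.
by move=> + s0; rewrite -(perm_mem (perm_eq_seq_mset s)) s0 in_mset0.
Qed.

(** * Orderings and the perturbed multiset *)

Section Orderings.
Variables (R : realType) (d : nat).
Implicit Types (s : seq 'rV[R]_d) (x y c h : 'rV[R]_d).

(** Reduces counting orderings to counting permutations of one fixed list. *)
Lemma orderings_seq s : uniq s -> orderings [set` s] = [set` permutations s].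
Proof.
move=> us; apply/seteqP; split => t /=; rewrite mem_permutations.
  move=> [ut ts]; apply: uniq_perm => // x.
  by apply/idP/idP => /ts.
by move=> ts; split=> [|x]; rewrite ?(perm_uniq ts) ?(perm_mem ts).
Qed.

Lemma dist_sum_seq_mset s x :
  dist_sum (seq_mset s) x = \sum_(v <- s) enorm (x - v).
Proof. by apply: perm_big; apply: perm_eq_seq_mset. Qed.

(** An injective map of a finite list into itself permutes it, so the sum can be reindexed by
    [f]. *)
Lemma sum_dist_isometry s (f : 'rV[R]_d -> 'rV[R]_d) x :
  uniq s -> eisometry f -> {in s, forall c, f c \in s} ->
  \sum_(c <- s) enorm (f x - c) = \sum_(c <- s) enorm (x - c).
Proof.
move=> us [/bij_inj finj fE] fs.
have ufs : uniq (map f s) by rewrite map_inj_uniq.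
have sub : {subset map f s <= s} by move=> _ /mapP[c cs ->]; apply: fs.
have [|_ eqs] := uniq_min_size ufs sub; first by rewrite size_map.
rewrite -(perm_big _ (uniq_perm ufs us eqs)) big_map.
by apply: eq_bigr => c _; rewrite fE.
Qed.

(** [index] starts at 0, hence the successor: even the first point is split once. Every point
    accounts for [2 * size s] entries in all. *)
Definition split_points s h : seq 'rV[R]_d :=
  flatten [seq nseq (index c s).+1 (c + h) ++ nseq (index c s).+1 (c - h) ++
               nseq (2 * size s - 2 * (index c s).+1) c | c <- s].

Lemma sum_split_points s h x :
  \sum_(v <- split_points s h) enorm (x - v) =
  (2 * size s)%:R * (\sum_(c <- s) enorm (x - c)) +
  \sum_(c <- s) (index c s).+1%:R * second_diff h (x - c).
Proof.
rewrite big_flatten big_map mulr_sumr -big_split.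
apply: eq_big_seq => c cs; rewrite [RHS]/=.
(* Makes the truncated subtraction in [split_points] exact. *)
have le_m : (2 * (index c s).+1 <= 2 * size s)%N by rewrite leq_mul2l index_mem.
have xDh : x - (c + h) = x - c - h by rewrite opprD addrA.
have xBh : x - (c - h) = x - c + h by rewrite opprB addrA addrAC.
rewrite !big_cat !sum_nseq xDh xBh natrB // (natrM _ 2 _.+1) /second_diff.
move: (enorm (x - c)) (enorm (x - c + h)) (enorm (x - c - h)) => p q r.
move: (_.+1%:R) (_%:R) => m n; rewrite [LHS]/=; ring.
Qed.

(** The terms of [x] at [x] and of [y] at [y] differ by at least [2 * enorm h]. The remaining terms
    are nonnegative, and those at [x] sum to at most [enorm h]. *)
Lemma split_points_increasing s h (e : R) :
  uniq s ->
  {in s &, forall x y, x != y -> e <= enorm (x - y)} ->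
  0 < enorm h -> (size s)%:R ^+ 2 * enorm h <= e ->
  {in s &, forall x y,
     \sum_(c <- s) enorm (x - c) = \sum_(c <- s) enorm (y - c)} ->
  {in s &, forall x y, (index x s < index y s)%N ->
    dist_sum (seq_mset (split_points s h)) x <
    dist_sum (seq_mset (split_points s h)) y}.
Proof.
move=> us es h0 he sumE x y xs ys xy.
rewrite !dist_sum_seq_mset !sum_split_points (sumE x y) // ltrD2l.
rewrite (bigD1_seq x xs us) (bigD1_seq y ys us) /= !subrr second_diff0.
set Ex := \sum_(c <- s | c != x) _; set Ey := \sum_(c <- s | c != y) _.
have Ey0 : 0 <= Ey.
  by apply: sumr_ge0 => c _; rewrite mulr_ge0 ?second_diff_ge0.
have n0 : (0 < size s)%N by case: (s) xs.
have e0 : 0 < e.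
  by apply: lt_le_trans he; rewrite mulr_gt0 // exprn_gt0 // ltr0n.
(* By [second_diff_le], each term of [Ex] times [e] is at most [(size s)%:R * enorm h ^+ 2]; there
   are at most [size s] terms. *)
have eEx : e * Ex <= e * enorm h.
  apply: (@le_trans _ _ (\sum_(c <- s) (size s)%:R * enorm h ^+ 2)); last first.
    rewrite big_const_seq count_predT iter_addr_0 -mulr_natl.
    by move: he h0; move: (enorm h) => r; nra.
  rewrite mulr_sumr [leRHS](bigID (fun c => c != x)) /=.
  rewrite -[leLHS]addr0 lerD //; last first.
    by apply: sumr_ge0 => c _; rewrite mulr_ge0 ?sqr_ge0.
  rewrite big_seq_cond [leRHS]big_seq_cond; apply: ler_sum => c /andP[cs cx].
  rewrite mulrCA; apply: ler_pM => //.
  - by rewrite mulr_ge0 ?second_diff_ge0 // ltW.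
  - by rewrite ler_nat index_mem.
  apply: le_trans (second_diff_le h (x - c)).
  by rewrite ler_wpM2r ?second_diff_ge0 // es // eq_sym.
rewrite ler_pM2l // in eEx.
have : (index x s).+1%:R + 1 <= (index y s).+1%:R :> R.
  by rewrite natr1 ler_nat.
move: (_.+1%:R) (_.+1%:R) => i j ij; nra.
Qed.

Lemma exists_increasing_mset s :
  uniq s ->
  {in s &, forall x y,
     \sum_(c <- s) enorm (x - c) = \sum_(c <- s) enorm (y - c)} ->
  exists2 V : {mset 'rV[R]_d}%mset, V <> mset0%mset &
    {in s &, forall x y, (index x s < index y s)%N ->
       dist_sum V x < dist_sum V y}.
Proof.
move=> us sumE.
have [s_small|s_big] := leqP (size s) 1.
  (* With at most one point no inequality is demanded, so any nonempty multiset serves. *)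
  exists (seq_mset [:: 0]) => [|x y xs ys]; first exact/seq_mset_neq0/mem_head.
  by rewrite -index_mem in ys => /leq_trans/(_ (leq_trans ys s_small)).
pose off_diag := [seq p <- [seq (x, y) | x <- s, y <- s] | p.1 != p.2].
have [|e e0 es] :=
    @finite_pos_lower_bound R _ off_diag (fun p => enorm (p.1 - p.2)).
  by move=> p; rewrite mem_filter => /andP[p12 _]; rewrite enorm_gt0 subr_eq0.
(* Two distinct points supply a nonzero direction for [h]. *)
have u0 : 0 < enorm (s`_0 - s`_1).
  by rewrite enorm_gt0 subr_eq0 nth_uniq // ltnW.
have n0 : 0 < (size s)%:R ^+ 2 :> R by rewrite exprn_gt0 // ltr0n ltnW.
(* Chosen so that [(size s)%:R ^+ 2 * enorm h] equals [e]. *)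
pose k := e / ((size s)%:R ^+ 2 * enorm (s`_0 - s`_1)).
have k0 : 0 < k by rewrite divr_gt0 // mulr_gt0.
pose h := k *: (s`_0 - s`_1).
have hE : enorm h = k * enorm (s`_0 - s`_1) by rewrite enormZ gtr0_norm.
exists (seq_mset (split_points s h)); last first.
  apply: (@split_points_increasing s h e) => //.
  - move=> x y xs ys xy; apply: (es (x, y)); rewrite mem_filter xy /=.
    by apply: allpairs_f.
  - by rewrite hE mulr_gt0.
  - by rewrite hE mulrCA divfK // mulf_neq0 // gt_eqF.
(* The first point is split at least once, so its shift by [h] occurs. *)
apply/(@seq_mset_neq0 _ _ (s`_0 + h))/flattenP.
eexists; first by apply: map_f; apply: (mem_nth 0 (ltnW s_big)).
by rewrite mem_cat mem_nseq eqxx.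
Qed.

End Orderings.

Theorem theorem7p7 (R : realType) (d : nat) (P C : set 'rV[R]_d) :
  polytope P -> vertex_transitive P -> C = vertices P ->
  [/\ finite_set C,
      Psi C = orderings C &
      (Psi C #= `I_((#|` fset_set C |)`!)%N)%card].
Proof.
move=> [S PE] tP CE.
have finC : finite_set C.
  apply: sub_finite_set (finite_seq S) => v.
  by rewrite CE PE => /vertices_convex_hull.
have PsiE : Psi C = orderings C.
  apply/seteqP; split => [s [V [_ []]]//|s Cs]; have [us sC] := Cs.
  have [V V0 Vlt] : exists2 V : {mset 'rV[R]_d}%mset, V <> mset0%mset &
      {in s &, forall x y, (index x s < index y s)%N ->
         dist_sum V x < dist_sum V y}.
    apply: exists_increasing_mset => // x y xs ys.
    have sP c : c \in s -> vertices P c by rewrite -CE => /sC.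
    have [f fsym <-] := tP x y (sP x xs) (sP y ys).
    rewrite (sum_dist_isometry _ us fsym.1) // => c /sP Pc.
    by apply/sC; rewrite CE; apply: symmetry_vertices fsym Pc.
  exists V; split => //; split => //.
    (* Distinct points of [C] have distinct indices in [s], so [Vlt] separates them in one direction
       or the other. *)
    move=> c c' /sC cs /sC cs' cc'.
    case: (ltngtP (index c s) (index c' s)) => [lt|lt|/index_inj eq].
    - by apply/eqP; rewrite lt_eqF // Vlt.
    - by apply/eqP; rewrite gt_eqF // Vlt.
    - by case: cc'; apply: eq.
  (* Comparing neighbours suffices; as [s] is duplicate-free, they have indices [i] and [i.+1]. *)
  apply/(sortedP 0) => i i_lt; have i_lt' := ltnW i_lt.
  by apply: Vlt; rewrite ?mem_nth ?index_uniq.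
split=> //; rewrite PsiE.
have [s us sE] : exists2 s, uniq s & C = [set` s].
  have /finite_seqP[s sE] := finC.
  by exists (undup s); rewrite ?undup_uniq // sE; apply/seteqP;
    split=> x /=; rewrite mem_undup.
rewrite sE orderings_seq // card_fset_set_seq // -size_permutations //.
exact/card_eq_seq/permutations_uniq.
Qed.
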